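(* The $q$-colour Ramsey number of any $k$-uniform hypergraph $H$ with $m$ edges and without isolated vertices satisfies \[ r(H,\ldots,H) \le t_k(c\sqrt{m}) \] for $k \ge 4$, and \[ r(H,\ldots,H) \le t_3(c\sqrt{m}\log m) \] for $k=3$, where the constant $c$ depends only on $k$ and $q$.
   Context: A hypergraph is $k$-uniform if every edge has exactly $k$ vertices. A vertex is isolated if it lies in no edge. The $q$-colour Ramsey number $r(H,\ldots,H)$ (with $q$ arguments) is the minimum $N$ such that every $q$-colouring of the edges of the complete $k$-uniform hypergraph on $N$ vertices contains a monochromatic copy of $H$ (a not necessarily induced subhypergraph isomorphic to $H$). The tower function $t_i(x)$ is defined by $t_1(x) = x$ and $t_{i+1}(x) = 2^{t_i(x)}$.
   Formalization: For k=3 the bound is stated only for m ≥ 2: at m = 1 it fails (a single edge has Ramsey number 3, while t_3(c·log 1) = t_3(0) = 2), and at m = 0 log m is undefined. *)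

(* Defs.v *)
From HB Require Import structures.
From mathcomp Require Import all_boot all_order all_algebra.
From mathcomp Require Import reals exp.

Set Implicit Arguments.
Unset Strict Implicit.
Unset Printing Implicit Defensive.

Import Order.TTheory GRing.Theory Num.Theory.

(* A hypergraph on the vertex set V is given by its edge set E : {set {set V}}. *)

Definition uniform (k : nat) (V : finType) (E : {set {set V}}) : Prop :=
  forall e, e \in E -> #|e| = k.

Definition isolated (V : finType) (E : {set {set V}}) (v : V) : Prop :=
  forall e, e \in E -> v \notin e.

Definition complete_hypergraph (k N : nat) : {set {set 'I_N}} :=
  [set e : {set 'I_N} | #|e| == k].

(* Not necessarily induced. *)
Definition contains_copy (W V : finType) (G : {set {set W}})
    (E : {set {set V}}) : Prop :=
  exists2 f : V -> W, injective f & forall e, e \in E -> f @: e \in G.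

(* A colouring is a function on all subsets of the vertex set; only its values
   on the edges of the complete k-uniform hypergraph are ever used. *)
Definition colour_class (k N q : nat) (chi : {set 'I_N} -> 'I_q) (a : 'I_q) :
    {set {set 'I_N}} :=
  [set e in complete_hypergraph k N | chi e == a].

Definition ramsey_property (k q : nat) (V : finType) (E : {set {set V}})
    (N : nat) : Prop :=
  forall chi : {set 'I_N} -> 'I_q,
    exists a : 'I_q, contains_copy (colour_class k chi a) E.

(* N = r(H, ..., H) with q arguments.  This is a relation, so asserting that some
   N satisfies it includes the existence of the Ramsey number. *)
Definition is_ramsey_number (k q : nat) (V : finType) (E : {set {set V}})
    (N : nat) : Prop :=
  ramsey_property k q E N /\
  forall N', ramsey_property k q E N' -> (N <= N')%N.

(* t_1(x) = x and t_{i+1}(x) = 2 ^ t_i(x) for i >= 1; the value at i = 0 is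
   meaningless. *)
Definition tower (R : realType) (i : nat) (x : R) : R :=
  iter i.-1 (fun y : R => 2 `^ y)%R x.

(* Main.v *)
(* A hypergraph with m edges has a strong colouring (every edge rainbow) with
   s = O(sqrt m) colours, so with n = |V| it embeds into the complete s-partite
   k-uniform hypergraph with parts of size n.  Let N be the Erdos-Rado bound
   t_k(O(s)) for a monochromatic complete hypergraph on s vertices.  Among N
   blocks of size M, every transversal contains a monochromatic s-set, so some s
   blocks and some colour work for a proportion at least 1 / (q N^s) of the
   transversals, and by Erdos' theorem on complete s-partite s-uniform
   hypergraphs these contain a full box of side n as soon as
   M >= n (4 q N^s)^((n + 2)^s).  Since n <= k m, the factor
   (n + 2)^s = 2^(O(sqrt m log m)) enters log N M; it is absorbed by log N when
   k >= 4, and accounts for the logarithm when k = 3. *)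

Require Import Defs.
From mathcomp Require Import all_boot all_order all_algebra.
From mathcomp Require Import zify ring.
From mathcomp Require Import boolp reals exp.

Set Implicit Arguments.
Unset Strict Implicit.
Unset Printing Implicit Defensive.

Import Order.TTheory GRing.Theory Num.Theory.

(** * Strong colourings with O(sqrt m) colours *)

(* In a strong colouring with the fewest colours any two colours meet in an
   edge, otherwise they could be merged. *)
Lemma exists_strong_colouring (k r : nat) (V : finType) (E : {set {set V}}) :
  uniform k E -> #|E| <= r ^ 2 ->
  exists f : V -> 'I_(k * r).+1, forall e, e \in E -> {in e &, injective f}.
Proof.
move=> uE Er.
(* Vertices themselves serve as colours: the colourings form a finite type, and the identity is
   strong. *)
pose good (g : {ffun V -> V}) := [forall e in E, #|g @: e| == #|e|].
have good0 : good [ffun x => x].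
  apply/forall_inP => e _; apply/imset_injP => x y _ _.
  by rewrite !ffunE.
case: (arg_minnP (fun g : {ffun V -> V} => #|g @: [set: V]|) good0) => g gg gmin.
set S := g @: [set: V] in gmin.
have ginj e : e \in E -> {in e &, injective g}.
  by move=> eE; apply/imset_injP; exact: (forall_inP gg).
have gS v : g v \in S by apply: imset_f.
have pairs a b : a \in S -> b \in S -> a != b ->
    exists2 e, e \in E & (a \in g @: e) && (b \in g @: e).
  move=> aS bS ab; suff : [exists e in E, (a \in g @: e) && (b \in g @: e)].
    by case/exists_inP => e eE he; exists e.
  apply: contraT => /exists_inPn nab.
  (* Recolouring [b] as [a] stays strong when no edge sees both colours, and it saves the colour
     [b]. *)
  pose g' := [ffun v => if g v == b then a else g v].
  have gg' : good g'.
    apply/forall_inP => e eE; apply/imset_injP => x y xe ye.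
    have := nab _ eE; have gx := imset_f g xe; have gy := imset_f g ye.
    rewrite !ffunE; case: eqP => [gxb|_]; case: eqP => [gyb|_] nabe; last first.
    - exact: (ginj _ eE).
    - by move=> gxa; move: nabe; rewrite -gxa -gyb gx gy.
    - by move=> gya; move: nabe; rewrite gya -gxb gx gy.
    - by move=> _; apply: (ginj _ eE) => //; rewrite gxb gyb.
  suff : #|g' @: [set: V]| < #|S| by rewrite ltnNge gmin.
  apply: proper_card; apply/properP; split.
    apply/subsetP => _ /imsetP[v _ ->]; rewrite ffunE.
    by case: ifP => // _; apply: gS.
  exists b => //; apply/negP => /imsetP[v _]; rewrite ffunE.
  by case: eqP => [_ ba | gvb /esym //]; rewrite ba eqxx in ab.
(* [S] x [S] is covered by its diagonal and the squares of the colour sets of the edges, so |S|^2 <=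
   |S| + (k r)^2. *)
have Ssz : #|S| <= (k * r).+1.
  pose dg := [set (a, a) | a in S].
  pose ps := \bigcup_(e in E) setX (g @: e) (g @: e).
  have sub : setX S S \subset dg :|: ps.
    apply/subsetP => -[a b] /setXP[aS bS]; rewrite inE.
    have [<-|ab] := eqVneq a b; first by rewrite imset_f.
    have [e eE /andP[ae be]] := pairs _ _ aS bS ab.
    by apply/orP; right; apply/bigcupP; exists e => //; apply/setXP.
  have dgc : #|dg| <= #|S| by apply: leq_imset_card.
  have psc : #|ps| <= #|E| * k ^ 2.
    rewrite -sum_nat_const; apply: (big_ind2 (fun (A : {set V * V}) n => #|A| <= n)).
    - by rewrite cards0.
    - by move=> A1 n1 A2 n2 h1 h2; rewrite (leq_trans (leq_card_setU _ _)) ?leq_add.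
    move=> e eE.
    by rewrite cardsX -(uE _ eE) expnS expn1 leq_mul ?leq_imset_card.
  have := leq_trans (subset_leq_card sub) (leq_card_setU _ _).
  rewrite cardsX => h; nia.
exists (fun v => inord (index (g v) (enum S))) => e eE x y xe ye exy.
have ltS v : index (g v) (enum S) < (k * r).+1.
  by apply: leq_trans Ssz; rewrite cardE index_mem mem_enum.
move/(congr1 (@nat_of_ord _)): exy; rewrite !inordK // => exy.
apply: (ginj _ eE) => //.
by rewrite -(nth_index (g x) (_ : g x \in enum S)) ?exy ?nth_index ?mem_enum.
Qed.

Lemma card_no_isolated (k : nat) (V : finType) (E : {set {set V}}) :
  uniform k E -> (forall v, ~ isolated E v) -> #|V| <= k * #|E|.
Proof.
move=> uE nE; rewrite -cardsT.
have -> : [set: V] = cover E.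
  apply/setP => v; rewrite inE; apply/esym/negPn/negP => vE.
  apply: (nE v) => e eE; apply: contra vE => ve.
  by apply/bigcupP; exists e.
apply: leq_trans (leq_card_cover _) _.
rewrite mulnC -sum_nat_const; apply: leq_sum => e /uE -> //.
Qed.

(** * The Erdos-Rado bound for complete hypergraphs *)

Lemma leq_bin_expn n k : 'C(n, k) <= n ^ k.
Proof.
apply: (@leq_trans (n ^_ k)); first by rewrite -bin_ffact leq_pmulr ?fact_gt0.
by rewrite ffact_prod -[k in n ^ k]card_ord -prod_nat_const; apply: leq_prod => i _; lia.
Qed.

(** Stated for subsets of any finite type, since the induction on [k] applies it inside a set built
    along the way. *)
Definition ramsey_complete (k q s N : nat) : Prop :=
  forall (T : finType) (U : {set T}) (chi : {set T} -> 'I_q), N <= #|U| ->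
  exists (S : {set T}) (a : 'I_q), [/\ S \subset U, #|S| = s &
    forall e : {set T}, e \subset S -> #|e| = k -> chi e = a].

Lemma exists_subset_card (T : finType) (U : {set T}) n :
  n <= #|U| -> exists2 S : {set T}, S \subset U & #|S| = n.
Proof.
move=> nU; have : 0 < #|[set A : {set T} | A \subset U & #|A| == n]|.
  by rewrite cards_draws bin_gt0.
by case/card_gt0P => S; rewrite inE => /andP[SU /eqP Sn]; exists S.
Qed.

Lemma pigeonhole_colour (T : finType) (q : nat) (W : {set T}) (f : T -> 'I_q) :
  0 < q -> exists a, #|W| <= q * #|[set x in W | f x == a]|.
Proof.
move=> q0; apply/existsP; apply: contraT => /existsPn h.
have : \sum_(a < q) q * #|[set x in W | f x == a]| < q * #|W|.
  rewrite (_ : q * #|W| = \sum_(a < q) #|W|); last by rewrite sum_nat_const card_ord.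
  have lt a : q * #|[set x in W | f x == a]| < #|W| by rewrite ltnNge.
  rewrite (bigD1 (Ordinal q0)) //= [ltnRHS](bigD1 (Ordinal q0)) //=.
  by rewrite -addSn leq_add // leq_sum // => a _; apply: ltnW.
rewrite -big_distrr /= ltnNge leq_mul2l => /negP[]; apply/orP; right.
rewrite -sum1_card (partition_big f xpredT) //=.
by apply: leq_sum => a _; rewrite -sum1_card; apply/eq_leq/eq_bigl => x; rewrite inE.
Qed.

Lemma ramsey_complete1 (q s : nat) : 0 < q -> ramsey_complete 1 q s (q * s).
Proof.
move=> q0 T U chi qU.
have [a ha] := pigeonhole_colour U (fun x => chi [set x]) q0.
have := leq_trans qU ha; rewrite leq_pmul2l // => /exists_subset_card[S SU Ss].
exists S, a; split=> //.
  by apply: subset_trans SU _; apply/subsetP => x; rewrite inE => /andP[].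
move=> e eS /eqP/cards1P[x ex]; move: eS; rewrite ex sub1set => /(subsetP SU).
by rewrite inE => /andP[_ /eqP].
Qed.

(** Pigeonhole on the colour of [x |: e], for one set [e] of [L] after another; each costs a factor
    [q]. *)
Lemma homogeneous_subset (T : finType) (q : nat) (chi : {set T} -> 'I_q)
    (L : seq {set T}) (W : {set T}) : 0 < q ->
  exists W' : {set T}, [/\ W' \subset W, #|W| <= q ^ size L * #|W'| &
    forall e, e \in L -> {in W' &, forall x y, chi (x |: e) = chi (y |: e)}].
Proof.
move=> q0; elim: L => [|e L [W1 [W1W cW1 hW1]]].
  by exists W; split => //; rewrite mul1n.
have [a ha] := pigeonhole_colour W1 (fun x => chi (x |: e)) q0.
set W2 := [set x in _ | _] in ha.
have W21 : W2 \subset W1 by apply/subsetP => x; rewrite inE => /andP[].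
exists W2; split; first exact: subset_trans W1W.
  by rewrite (leq_trans cW1) //= expnSr -mulnA leq_mul2l ha orbT.
move=> e'; rewrite inE => /predU1P[-> x y|/hW1 h x y xW yW].
  by rewrite !inE => /andP[_ /eqP->] /andP[_ /eqP->].
by apply: h; apply: (subsetP W21).
Qed.

(* In the last clause x is the vertex of f that was added to A last: the colour
   of f does not change when x is replaced by any vertex of W. *)
Lemma erdos_rado_sequence (k q t B : nat) (T : finType) (U : {set T})
    (chi : {set T} -> 'I_q) :
  0 < q -> 0 < k -> t ^ k.-1 <= B ->
  (2 * q) ^ (B * t) <= #|U| ->
  forall j, j <= t ->
  exists A W : {set T}, [/\ A \subset U, [disjoint A & W], #|A| = j,
    (2 * q) ^ (B * (t - j)) <= #|W| &
    (forall e : {set T}, e \subset A -> #|e| = k ->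
       {in W &, forall x y, chi (x |: e) = chi (y |: e)}) /\
    (forall f : {set T}, f \subset A -> #|f| = k.+1 ->
       exists2 x, x \in f & {in W, forall w, chi f = chi (w |: (f :\ x))})] /\
    W \subset U.
Proof.
move=> q0 k0 tB hU; elim=> [_|j IH jt].
  exists set0, U; split; last by [].
  rewrite subn0 cards0 -setI_eq0 set0I sub0set; split=> //; split.
    by move=> e; rewrite subset0 => /eqP->; rewrite cards0 => k00; rewrite -k00 in k0.
  by move=> e; rewrite subset0 => /eqP->; rewrite cards0.
have [A [W [[AU dAW cA cW [hom lst]] WU]]] := IH (ltnW jt).
have W0 : 0 < #|W| by apply: leq_trans cW; rewrite expn_gt0 muln_gt0 q0.
case/card_gt0P: W0 => v vW.
(* Only the [k]-sets through the new vertex [v] must be made homogeneous; the others lie in [A] and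
   already are. *)
pose L := [seq v |: e | e : {set T} <- enum [set e : {set T} | e \subset A & #|e| == k.-1]].
have szL : size L <= B.
  rewrite size_map -cardE cards_draws; apply: leq_trans (leq_bin_expn _ _) _.
  by apply: leq_trans tB; rewrite cA; case: (k.-1) => // l; rewrite leq_exp2r // ltnW.
have [W' [W'W cW' hW']] := homogeneous_subset chi L (W :\ v) q0.
have vA : v \notin A by apply/negP => vA; move/disjointFr/(_ vA): dAW; rewrite vW.
have W'W0 : W' \subset W by apply: subset_trans W'W _; apply: subD1set.
exists (v |: A), W'; split; last exact: subset_trans WU.
split.
- by rewrite subUset sub1set (subsetP WU) // AU.
- rewrite -setI_eq0 -subset0; apply/subsetP => x; rewrite !inE => /andP[/predU1P[->|xA] xW'].
    by move/(subsetP W'W): xW'; rewrite !inE eqxx.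
  by move/disjointFr/(_ xA): dAW; rewrite (subsetP W'W0).
- by rewrite cardsU1 vA cA.
(* Homogenising costs at most q^B out of (2q)^B; the spare 2^B pays for the removal of [v]. *)
- have cWv : #|W| = #|W :\ v|.+1 by rewrite (cardsD1 v W) vW.
  move: cW; rewrite -(subnSK jt) mulnS expnD expnMn.
  set X := (2 * q) ^ _ => cW; rewrite leqNgt; apply/negP => lt.
  have qB : q ^ size L <= q ^ B by rewrite leq_pexp2l.
  have B0 : 0 < B by apply: leq_trans tB; rewrite expn_gt0; lia.
  have p2 : 2 <= 2 ^ B by rewrite -[2 in leqLHS]expn1 leq_pexp2l.
  have qB0 : 0 < q ^ B by rewrite expn_gt0 q0.
  have X0 : 0 < X by lia.
  have h1 : #|W :\ v| <= q ^ B * X.-1.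
    by apply: leq_trans cW' _; apply: leq_mul => //; lia.
  have h2 : 2 * (q ^ B * X) <= 2 ^ B * q ^ B * X by rewrite -mulnA leq_mul2r p2 orbT.
  have h3 : q ^ B * X = q ^ B * X.-1 + q ^ B by rewrite -mulnSr prednK.
  lia.
split=> [e eA ek x y xW' yW' | f fA fk].
  have [ve|ve] := boolP (v \in e); last first.
    apply: hom => //; try exact: (subsetP W'W0).
    apply/subsetP => z ze; move/(subsetP eA): (ze); rewrite !inE => /predU1P[zv|//].
    by rewrite -zv ze in ve.
  apply: hW' => //; apply/mapP; exists (e :\ v); last by rewrite setD1K.
  rewrite mem_enum inE subDset eA /=; move: ek; rewrite (cardsD1 v e) ve => <-.
  by rewrite /= eqxx.
have [vf|vf] := boolP (v \in f); last first.
  have fA' : f \subset A.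
    apply/subsetP => z ze; move/(subsetP fA): (ze); rewrite !inE => /predU1P[zv|//].
    by rewrite -zv ze in vf.
  have [x xf hx] := lst _ fA' fk; exists x => // w wW'.
  by apply: hx; apply: (subsetP W'W0).
(* [f :\ v] is a [k]-set of the old [A], and both [v] and [w] lie in the old [W], which is
   homogeneous for it. *)
exists v => // w wW'; rewrite -[in LHS](setD1K vf); apply: hom => //.
- by rewrite subDset.
- by move: fk; rewrite (cardsD1 v f) vf => -[].
- exact: (subsetP W'W0).
Qed.

(** Build a sequence [A] of length [N] and fix a vertex [w] left over. The colour of a (k+1)-set of
    [A] is that of [w] joined to the set minus its last vertex, so a set homogeneous for the
    [k]-sets e coloured by [chi (w |: e)] is homogeneous for [chi]. *)
Lemma erdos_rado_step (k q s N : nat) : 0 < q -> 0 < k ->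
  ramsey_complete k q s N -> ramsey_complete k.+1 q s ((2 * q) ^ (N ^ k)).
Proof.
move=> q0 k0 IH T U chi hU.
have hU' : (2 * q) ^ (N ^ k.-1 * N) <= #|U| by rewrite -expnSr prednK.
have [A [W [[AU _ cA cW [_ lst]] _]]] :=
  erdos_rado_sequence chi q0 k0 (leqnn _) hU' (leqnn N).
have W0 : 0 < #|W| by apply: leq_trans cW; rewrite expn_gt0 muln_gt0 q0.
case/card_gt0P: W0 => w wW.
have [S [a [SA Ss Sa]]] := IH T A (fun e => chi (w |: e)) (eq_leq (esym cA)).
exists S, a; split=> //; first exact: subset_trans AU.
move=> f fS fk; have [x xf hx] := lst f (subset_trans fS SA) fk.
rewrite (hx w wW) Sa //; first by apply: subset_trans fS; apply: subD1set.
by move: fk; rewrite (cardsD1 x f) xf => -[].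
Qed.

(** * Boxes in dense subsets of a product *)

(** Compare falling factorials factor by factor: for i < n, 4 D (b - i) >= 2 z - z >= z - i. *)
Lemma leq_bin_scale (D n z b : nat) : z <= 2 * D * b -> n * (4 * D) <= z ->
  'C(z, n) <= (4 * D) ^ n * 'C(b, n).
Proof.
move=> zb nz; rewrite -(leq_pmul2r (fact_gt0 n)) -mulnA !bin_ffact !ffact_prod.
rewrite -[n in (4 * D) ^ n]card_ord -prod_nat_const -big_split /=.
apply: leq_prod => i _; have := ltn_ord i; nia.
Qed.

(** Double counting of the pairs (T, y) with T inside [B y]. At least 1 / (2 D) of the y have |B y|
    >= |Z| / (2 D), and each such [B y] contains a share 1 / (4 D)^n of all [n]-sets; an average
    [n]-set is popular enough. *)
Lemma exists_popular_subset (Y Z : finType) (B : Y -> {set Z}) (D n : nat) :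
  0 < D -> 0 < n -> #|Y| * #|Z| <= D * (\sum_y #|B y|) -> n * (4 * D) <= #|Z| ->
  exists2 T : {set Z}, #|T| = n &
    #|Y| <= 2 * D * (4 * D) ^ n * #|[set y | T \subset B y]|.
Proof.
move=> D0 n0 dens nZ.
pose G := [set y | #|Z| <= 2 * D * #|B y|].
have Z0 : 0 < #|Z| by apply: leq_trans nZ; rewrite !muln_gt0 n0 D0.
have cG : #|Y| <= 2 * D * #|G|.
  have : \sum_y 2 * D * #|B y| <= \sum_(y in G) 2 * D * #|Z| + \sum_(y : Y) #|Z|.
    rewrite (bigID [in G]) /= leq_add //.
      by apply: leq_sum => y _; rewrite leq_mul2l max_card orbT.
    rewrite [leqRHS](bigID [in G]) /=; apply: leq_trans (leq_addl _ _).
    by apply: leq_sum => y; rewrite inE -ltnNge => /ltnW.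
  rewrite -big_distrr /= !sum_nat_const => h.
  rewrite -(leq_pmul2r Z0); move: dens h; move: (\sum_y _) (#|_|) (#|_|) (#|_|) => t g y z.
  by rewrite -(leq_pmul2l (isT : 0 < 2)); lia.
have CZ0 : 0 < 'C(#|Z|, n) by rewrite bin_gt0; apply: leq_trans nZ; rewrite leq_pmulr ?muln_gt0 ?D0.
pose P := [set T : {set Z} | #|T| == n].
have cP : #|P| = 'C(#|Z|, n) by rewrite /P card_draws.
pose c (T : {set Z}) := #|[set y | T \subset B y]|.
have cnt : \sum_(T in P) c T = \sum_y 'C(#|B y|, n).
  transitivity (\sum_(T in P) \sum_(y | T \subset B y) 1).
    by apply: eq_bigr => T _; rewrite /c -sum1_card; apply: eq_bigl => y; rewrite inE.
  rewrite (exchange_big_dep xpredT) //=; apply: eq_bigr => y _.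
  rewrite -cards_draws -sum1_card; apply: eq_bigl => T.
  by rewrite !inE andbC.
have [T TP hT] : exists2 T, T \in P & #|Y| <= 2 * D * (4 * D) ^ n * c T.
  apply/exists_inP; apply: contraT => /exists_inPn h.
  have h1 : 2 * D * (4 * D) ^ n * (\sum_(T in P) c T) < #|Y| * #|P|.
    have [T0 T0P] : exists T0, T0 \in P by apply/card_gt0P; rewrite cP.
    rewrite [ltnRHS]mulnC -sum_nat_const big_distrr /= (bigD1 T0) //= [ltnRHS](bigD1 T0) //=.
    rewrite -addSn; apply: leq_add; first by rewrite ltnNge h.
    by apply: leq_sum => T /andP[TP _]; rewrite ltnW // ltnNge h.
  have h2 : #|G| * 'C(#|Z|, n) <= (4 * D) ^ n * (\sum_(T in P) c T).
    rewrite cnt big_distrr /= [leqRHS](bigID [in G]) /=.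
    apply: leq_trans (leq_addr _ _); rewrite -sum_nat_const; apply: leq_sum => y.
    by rewrite inE => yG; apply: leq_bin_scale.
  move: h1; rewrite cP ltnNge -mulnA => /negP[].
  apply: leq_trans (leq_mul (leqnn (2 * D)) h2).
  by rewrite mulnA leq_mul2r cG orbT.
by exists T => //; apply/eqP; rewrite inE in TP.
Qed.

(* Erdos' theorem, one coordinate of s at a time: each step turns the density
   1 / D into 1 / (2 D (4 D)^n), and 4 * 2 D (4 D)^n <= (4 D)^(n + 2).  The
   coordinates outside s are frozen to those of x. *)
Lemma exists_box (I : finType) (M n : nat) (s : seq I) (A : {set {ffun I -> 'I_M}})
    (D : nat) :
  0 < n -> 0 < D -> uniq s -> M ^ #|I| <= D * #|A| ->
  n * (4 * D) ^ (n.+2 ^ size s) <= M ->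
  exists (T : I -> {set 'I_M}) (x : {ffun I -> 'I_M}),
    (forall i, i \in s -> #|T i| = n) /\
    forall y : {ffun I -> 'I_M}, (forall i, i \in s -> y i \in T i) ->
      (forall i, i \notin s -> y i = x i) -> y \in A.
Proof.
move=> n0; elim: s A D => [|i s IH] A D D0 us hA hM.
  have M0 : 0 < M by apply: leq_trans hM; rewrite muln_gt0 n0 expn_gt0 muln_gt0 D0.
  have A0 : 0 < #|A|.
    by have := leq_trans (_ : 0 < M ^ #|I|) hA; rewrite expn_gt0 M0 muln_gt0 => /(_ isT) /andP[].
  case/card_gt0P: A0 => x xA; exists (fun=> set0), x; split=> // y _ yx.
  by rewrite (_ : y = x) //; apply/ffunP => j; apply: yx.
pose upd (x : {ffun I -> 'I_M}) z := [ffun j => if j == i then z else x j].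
have updK x z : upd (upd x z) (x i) = x.
  by apply/ffunP => j; rewrite !ffunE; case: eqP => // ->.
have updi x z : upd x z i = z by rewrite ffunE eqxx.
pose B x := [set z | upd x z \in A].
have sumB : \sum_x #|B x| = M * #|A|.
  transitivity (\sum_(p : {ffun I -> 'I_M} * 'I_M | upd p.1 p.2 \in A) 1).
    rewrite -(pair_big_dep xpredT (fun x z => upd x z \in A) (fun _ _ => 1)) /=.
    by apply: eq_bigr => x _; rewrite -sum1_card; apply: eq_bigl => z; rewrite inE.
  (* Exchanging [z] with the coordinate [i] of [x] turns the condition on [upd x z] into [x \in A]
     with [z] free. *)
  pose h (p : {ffun I -> 'I_M} * 'I_M) := (upd p.1 p.2, p.1 i).
  have hK : involutive h.
    by move=> [x z]; rewrite /h /= updK updi.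
  rewrite (reindex_inj (inv_inj hK)) /=.
  rewrite (eq_bigl (fun p => (p.1 \in A) && xpredT p.2)); last first.
    by move=> [x z] /=; rewrite updK andbT.
  rewrite -(pair_big (mem A) xpredT (fun _ _ => 1)) /= sum_nat_const sum1_card.
  by rewrite card_ord mulnC.
have D40 : 0 < 4 * D by rewrite muln_gt0 D0.
have hM1 : n * (4 * D) <= #|'I_M|.
  rewrite card_ord; apply: leq_trans hM; rewrite leq_mul2l -[4 * D in leqLHS]expn1.
  by rewrite leq_pexp2l ?expn_gt0 ?orbT.
have dens : #|{ffun I -> 'I_M}| * #|'I_M| <= D * \sum_x #|B x|.
  by rewrite sumB card_ffun !card_ord mulnC mulnCA leq_mul2l hA orbT.
have [T0 T0n hT0] := exists_popular_subset D0 n0 dens hM1.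
case/andP: us => nis us.
pose D' := 2 * D * (4 * D) ^ n.
have D'0 : 0 < D' by rewrite !muln_gt0 D0 expn_gt0 D40.
have hA' : M ^ #|I| <= D' * #|[set x | T0 \subset B x]| by move: hT0; rewrite card_ffun card_ord.
have hM' : n * (4 * D') ^ (n.+2 ^ size s) <= M.
  apply: leq_trans hM; rewrite leq_mul2l /= expnS expnM leq_exp2r ?expn_gt0 //.
  rewrite (_ : 4 * D' = 2 * (4 * D) * (4 * D) ^ n); last by rewrite /D'; lia.
  by rewrite !expnS; move: ((4 * D) ^ n) => X; nia.
have [T [x [Tn hT]]] := IH _ _ D'0 us hA' hM'.
exists (fun j => if j == i then T0 else T j), x; split.
  move=> j; rewrite inE => /predU1P[->|js]; first by rewrite eqxx.
  by case: eqP => // _; apply: Tn.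
move=> y yT yx.
have yi : y i \in T0 by have := yT i (mem_head _ _); rewrite eqxx.
(* For the smaller list [i] is a frozen coordinate, so it is first reset to [x i]; membership of
   [y i] in [T0] then puts it back. *)
have : upd y (x i) \in [set x | T0 \subset B x].
  apply: hT => j js.
    have ji : j == i = false by apply: contraNF nis => /eqP <-.
    by rewrite ffunE ji; have := yT j; rewrite ji inE js orbT; apply.
  rewrite ffunE; have [->//|ji] := eqVneq j i.
  by apply: yx; rewrite inE negb_or ji.
by rewrite inE => /subsetP/(_ _ yi); rewrite inE updK.
Qed.

(** * Monochromatic blow-ups and the embedding *)

(** The side [exists_box] asks for in [s] coordinates at density 1 / (N^s q), where [N ^ s * q]
    counts the choices of [s] blocks in order and a colour. *)
Definition blowup_size (q s n N : nat) : nat :=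
  n * (4 * (N ^ s * q)) ^ (n.+2 ^ s).

Lemma exists_injection_into (V Z : finType) (B : {set Z}) :
  #|V| <= #|B| -> exists2 f : V -> Z, injective f & forall v, f v \in B.
Proof.
move=> VB; exists (fun v => enum_val (widen_ord VB (enum_rank v))).
  by move=> u v /enum_val_inj /(congr1 (@nat_of_ord _)) /= /val_inj /enum_rank_inj.
by move=> v; apply: enum_valP.
Qed.

Lemma enum_subset_inj (T : finType) (S : {set T}) (s : nat) : #|S| = s ->
  exists2 g : {ffun 'I_s -> T}, injective g & forall i, g i \in S.
Proof.
move=> Ss; have [|g ginj gS] := @exists_injection_into 'I_s T S; first by rewrite card_ord Ss.
by exists (finfun g) => [i j|i]; rewrite !ffunE //; apply: ginj.
Qed.

Lemma mono_blowup (k q s n N : nat) (W : finType) (chi : {set W} -> 'I_q)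
    (h : 'I_N -> 'I_(blowup_size q s n N) -> W) :
  0 < q -> 0 < n -> 0 < N -> ramsey_complete k q s N ->
  exists (a : 'I_q) (g : {ffun 'I_s -> 'I_N})
      (T : 'I_s -> {set 'I_(blowup_size q s n N)}),
    [/\ injective g, forall i, #|T i| = n &
     forall y : 'I_s -> 'I_(blowup_size q s n N), (forall i, y i \in T i) ->
       forall e : {set 'I_s}, #|e| = k -> chi [set h (g i) (y i) | i in e] = a].
Proof.
move=> q0 n0 N0 ram; set M := blowup_size q s n N in h *.
(* [x] is a transversal picking one position in each block; [p] is a choice of distinct blocks and a
   colour that work for it. *)
pose P (p : {ffun 'I_s -> 'I_N} * 'I_q) (x : {ffun 'I_N -> 'I_M}) :=
  injectiveb p.1 &&
  [forall e : {set 'I_s}, (#|e| == k) ==> (chi [set h (p.1 i) (x (p.1 i)) | i in e] == p.2)].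
have covered x : exists p, P p x.
  have cN : N <= #|[set: 'I_N]| by rewrite cardsT card_ord.
  have [S [a [_ Ss mono]]] := ram _ _ (fun e => chi [set h i (x i) | i in e]) cN.
  have [g ginj gS] := enum_subset_inj Ss.
  exists (g, a); apply/andP; split; first exact/injectiveP.
  apply/forall_inP => e /eqP ek; apply/eqP.
  rewrite -(mono [set g i | i in e]); first by rewrite -imset_comp.
    by apply/subsetP => _ /imsetP[i _ ->].
  by rewrite card_imset.
have [p hp] : exists p, M ^ N <= (N ^ s * q) * #|[set x | P p x]|.
  apply/existsP; apply: contraT => /existsPn hn.
  have card_p : #|{: {ffun 'I_s -> 'I_N} * 'I_q}| = N ^ s * q.
    by rewrite card_prod card_ffun !card_ord.
  have [p0 _] : exists p0 : {ffun 'I_s -> 'I_N} * 'I_q, true.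
    by exists ([ffun=> Ordinal N0], Ordinal q0).
  have lt p : N ^ s * q * #|[set x | P p x]| < M ^ N by rewrite ltnNge.
  have h1 : \sum_p N ^ s * q * #|[set x | P p x]| < \sum_(p : {ffun 'I_s -> 'I_N} * 'I_q) M ^ N.
    rewrite (bigD1 p0) //= [ltnRHS](bigD1 p0) //= -addSn leq_add //.
    by apply: leq_sum => p _; apply: ltnW.
  move: h1; rewrite -big_distrr /= sum_nat_const card_p ltnNge leq_mul2l => /negP[].
  apply/orP; right.
  have -> : M ^ N = #|{ffun 'I_N -> 'I_M}| by rewrite card_ffun !card_ord.
  rewrite -cardsT -sum1_card.
  apply: leq_trans (_ : \sum_(x : {ffun 'I_N -> 'I_M}) \sum_(p | P p x) 1 <= _).
    rewrite (eq_bigl xpredT) => [|x]; last by rewrite inE.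
    apply: leq_sum => x _; rewrite sum1_card; have [p Pp] := covered x.
    by apply/card_gt0P; exists p.
  rewrite (exchange_big_dep xpredT) //=; apply: leq_sum => p _.
  by rewrite -sum1_card; apply/eq_leq/eq_bigl => x; rewrite inE.
have [x0 Px0] : exists x, P p x.
  have M0 : 0 < M by rewrite muln_gt0 n0 expn_gt0 !muln_gt0 expn_gt0 N0 q0.
  have : 0 < M ^ N by rewrite expn_gt0 M0.
  move/leq_trans/(_ hp); rewrite muln_gt0 => /andP[_ /card_gt0P[x]].
  by rewrite inE; exists x.
case/andP: Px0 => /injectiveP ginj _; case: p ginj hp => g a /= ginj hp.
have D0 : 0 < N ^ s * q by rewrite muln_gt0 expn_gt0 N0 q0.
have uc : uniq (codom g) by apply/injectiveP.
have [||T [x [Tn hT]]] := exists_box n0 D0 uc (A := [set x | P (g, a) x]) (M := M).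
- by rewrite card_ord.
- by rewrite size_codom card_ord.
exists a, g, (T \o g); split=> // [i|y yT e ek]; first by apply: Tn; apply: codom_f.
pose y' : {ffun 'I_N -> 'I_M} :=
  [ffun j => if [pick i | g i == j] is Some i then y i else x j].
have y'g i : y' (g i) = y i.
  by rewrite ffunE; case: pickP => [j /eqP/ginj->|/(_ i)]; rewrite ?eqxx.
have : y' \in [set x | P (g, a) x].
  apply: hT => j; first by move=> /codomP[i ->]; rewrite y'g.
  by rewrite ffunE; case: pickP => // i /eqP <-; rewrite codom_f.
rewrite inE => /andP[_ /forall_inP /(_ e)]; rewrite ek eqxx => /(_ isT) /eqP /= <-.
by congr chi; apply: eq_imset => i; rewrite y'g.
Qed.

(** A vertex [v] goes to the block [g (f v)], at the position given by an injection of [V] into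
    [T (f v)]; this is why the box needs side at least |V|. A rainbow edge then extends to a
    transversal of the box. *)
Lemma ramsey_property_blowup (k q s n N : nat) (V : finType) (E : {set {set V}})
    (f : V -> 'I_s) :
  0 < q -> 0 < n -> 0 < N -> #|V| <= n -> uniform k E ->
  (forall e, e \in E -> {in e &, injective f}) ->
  ramsey_complete k q s N ->
  ramsey_property k q E (N * blowup_size q s n N).
Proof.
move=> q0 n0 N0 Vn uE finj ram chi.
(* [mxvec_index] encodes a pair of a block and a position as one vertex. *)
have [a [g [T [ginj Tn mono]]]] :=
  mono_blowup chi (@mxvec_index N (blowup_size q s n N)) q0 n0 N0 ram.
have hinj i j i' j' : @mxvec_index N (blowup_size q s n N) i j = mxvec_index i' j' ->
    (i, j) = (i', j').
  by move=> /cast_ord_inj /enum_rank_inj.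
have /fin_all_exists[tau htau] (i : 'I_s) : exists t : V -> 'I_(blowup_size q s n N),
    injective t /\ forall v, t v \in T i.
  by have [|t] := @exists_injection_into V _ (T i); [rewrite Tn | exists t].
have /fin_all_exists[d hd] (i : 'I_s) : exists z, z \in T i.
  by apply/card_gt0P; rewrite Tn.
pose F v := @mxvec_index N (blowup_size q s n N) (g (f v)) (tau (f v) v).
have Finj : injective F.
  by move=> u v /hinj[/ginj fuv]; rewrite fuv => /(htau _).1.
exists a, F => // e eE; rewrite !inE card_imset // (uE _ eE) eqxx /=; apply/eqP.
(* The edge has at most one vertex of each colour; colours it misses get the arbitrary point [d i]
   of the box. *)
pose y i := if [pick v in e | f v == i] is Some v then tau i v else d i.
have yf v : v \in e -> y (f v) = tau (f v) v.
  rewrite /y => ve; case: pickP => [u /andP[ue /eqP fuv]|/(_ v)]; last by rewrite ve eqxx.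
  by rewrite (finj _ eE _ _ ue ve fuv).
rewrite -(mono y _ (f @: e)); first 1 last.
- by move=> i; rewrite /y; case: pickP => [v _|_]; [apply: (htau i).2 | apply: hd].
- by rewrite card_in_imset ?(uE _ eE) //; apply: finj.
rewrite -imset_comp; congr chi; apply: eq_in_imset => v ve.
by rewrite /F /= yf.
Qed.

(** * Numerical estimates with towers *)

(* The index is shifted by one from [t_i]: [er_bound q s j] is for
   [(j + 1)]-uniform hypergraphs and [tower2 j] is [t_(j + 1)]. *)
Fixpoint er_bound (q s j : nat) : nat :=
  if j is i.+1 then (2 * q) ^ (er_bound q s i ^ i.+1) else q * s.

Definition tower2 (j x : nat) : nat := iter j (expn 2) x.

Lemma ramsey_complete_er_bound (q s j : nat) :
  0 < q -> ramsey_complete j.+1 q s (er_bound q s j).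
Proof.
move=> q0; elim: j => [|j IH]; first exact: ramsey_complete1.
exact: erdos_rado_step.
Qed.

Lemma er_bound_gt0 (q s j : nat) : 0 < q -> 0 < s -> 0 < er_bound q s j.
Proof. by case: j => [|j] q0 s0; rewrite /= ?expn_gt0 muln_gt0 q0. Qed.

Lemma leq_tower2 (j x y : nat) : x <= y -> tower2 j x <= tower2 j y.
Proof. by move=> xy; elim: j => //= j; rewrite leq_exp2l. Qed.

Lemma tower2_gt0 (j x : nat) : 0 < x -> 0 < tower2 j x.
Proof. by case: j => //= j _; rewrite expn_gt0. Qed.

Lemma leq_tower2D (i j x : nat) : tower2 i x <= tower2 (j + i) x.
Proof.
elim: j => // j IH; rewrite addSn /=; apply: leq_trans IH _.
exact/ltnW/ltn_expl.
Qed.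

(** A factor moves up one level because a <= 2^(a-1) <= 2^((a-1) t), hence a 2^t <= 2^(a t). *)
Lemma mul_tower2 (a j x : nat) : 0 < a -> 0 < x -> a * tower2 j x <= tower2 j (a * x).
Proof.
move=> a0 x0; elim: j => //= j IH.
apply: leq_trans (_ : 2 ^ (a * tower2 j x) <= _); last by rewrite leq_exp2l.
have T0 := tower2_gt0 j x0; set t := tower2 j x in T0 *.
have ha : a <= 2 ^ a.-1 by have := ltn_expl a.-1 (isT : 1 < 2); rewrite prednK.
apply: (@leq_trans (2 ^ (a.-1 * t) * 2 ^ t)).
  by rewrite leq_mul2r (leq_trans ha) ?orbT // leq_exp2l // leq_pmulr.
by rewrite -expnD leq_exp2l // -mulSnr prednK.
Qed.

Lemma er_bound_le_tower2 (q j : nat) : 0 < q ->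
  exists2 c, 0 < c & forall s, 0 < s -> er_bound q s j <= tower2 j (c * s).
Proof.
move=> q0; have q20 : 0 < 2 * q by rewrite muln_gt0.
have base a : (2 * q) ^ a <= 2 ^ (2 * q * a).
  by rewrite expnM; case: a => // a; rewrite leq_exp2r // ltnW // ltn_expl.
(* From the third level on, the previous bound is itself a power 2^T, so raising it to [j.+2] only
   multiplies T by a constant. At the second level the exponent is 1. *)
elim: j => [|[|j] [c c0 IH]]; first by exists q.
  exists (2 * q * c) => [|s s0]; first by rewrite muln_gt0 q20.
  rewrite [er_bound _ _ _]/= expn1; apply: leq_trans (base _) _.
  by rewrite /= leq_exp2l // -[leqRHS]mulnA leq_mul2l (IH s s0) orbT.
exists ((2 * q + j.+2) * c) => [|s s0]; first by rewrite muln_gt0 c0 addn_gt0 q20.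
rewrite [er_bound _ _ _]/=; apply: leq_trans (base _) _.
rewrite [tower2 _ _]/= leq_exp2l //.
have cs0 : 0 < c * s by rewrite muln_gt0 c0.
have T0 := tower2_gt0 j cs0.
have := IH s s0; rewrite [er_bound _ _ _]/= [tower2 _ _]/= => le.
apply: leq_trans (_ : 2 * q * (2 ^ tower2 j (c * s)) ^ j.+2 <= _).
  by rewrite leq_mul2l leq_exp2r // le orbT.
rewrite -expnM; apply: leq_trans (_ : 2 ^ (2 * q) * 2 ^ (tower2 j (c * s) * j.+2) <= _).
  by rewrite leq_mul2r (ltnW (ltn_expl _ _)) ?orbT.
rewrite -expnD leq_exp2l //; rewrite -mulnA.
apply: leq_trans (mul_tower2 _ _ cs0); last by rewrite addn_gt0 q20.
by rewrite mulnDl leq_add // ?leq_pmulr // mulnC.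
Qed.

(** The exponent is at most (L + n + 2 + L s + q) (n + 2)^s; a single product is cruder but lets the
    factors be estimated separately. *)
Lemma blowup_size_le (q s n N L : nat) : N <= 2 ^ L -> 0 < L -> 0 < s ->
  N * blowup_size q s n N <= 2 ^ ((q + 3) * L * s * n.+2 ^ s.+1).
Proof.
move=> NL L0 s0; rewrite /blowup_size; set B := n.+2 ^ s.
have B0 : 0 < B by rewrite expn_gt0.
have h4 : 4 * (N ^ s * q) <= 2 ^ (2 + (L * s + q)).
  rewrite expnD leq_mul2l /= expnD expnM leq_mul ?leq_exp2r //.
  exact/ltnW/ltn_expl.
apply: (@leq_trans (2 ^ L * (2 ^ n * (2 ^ (2 + (L * s + q))) ^ B))).
  rewrite !leq_mul //; first exact/ltnW/ltn_expl.
  by rewrite leq_exp2r.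
rewrite -expnM -!expnD leq_exp2l // expnS -/B.
apply: (@leq_trans ((L + n.+2 + L * s + q) * B)).
  by nia.
rewrite [n.+2 * B]mulnC mulnCA mulnC leq_mul2l; apply/orP; right.
have h : 0 < L * s by rewrite muln_gt0 L0.
nia.
Qed.

(** As m >= 2, every factor of the exponent is at most a power of [m], the dominant (3 m + 2)^(s +
    1) being m^O(r). Here [r] stands for sqrt m. *)
Lemma ramsey_bound_uniform3 (q : nat) : 0 < q -> exists2 C : nat, 0 < C &
  forall m r, 2 <= m -> 0 < r ->
    er_bound q (3 * r).+1 2 *
      blowup_size q (3 * r).+1 (3 * m) (er_bound q (3 * r).+1 2) <= 2 ^ (m ^ (C * r)).
Proof.
move=> q0; have [c c0 hc] := er_bound_le_tower2 2 q0.
(* The powers of [m] add up to (q + 3) + c s + s + 4 (s + 1), and s <= 4 r. *)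
exists ((q + c + 12) * 4) => [|m r m2 r0]; first by rewrite muln_gt0 addn_gt0 orbT.
set s := (3 * r).+1.
apply: leq_trans (blowup_size_le (s := s) (L := 2 ^ (c * s)) q _ (hc s isT) _ isT) _.
  by rewrite expn_gt0.
rewrite leq_exp2l //= /tower2 /=.
have pow2 a : 2 ^ a <= m ^ a by case: a => // a; rewrite leq_exp2r.
have lin a : a <= m ^ a by apply: leq_trans (pow2 a); apply/ltnW/ltn_expl.
have m4 : (3 * m).+2 <= m ^ 4.
  have m22 : 2 * m <= m ^ 2 by rewrite leq_mul2r m2 orbT.
  by rewrite (expnM m 2 2); apply: leq_trans (_ : (2 * m) ^ 2 <= _); rewrite ?leq_exp2r // expnMn; lia.
apply: (@leq_trans (m ^ (q + 3) * m ^ (c * s) * m ^ s * (m ^ 4) ^ s.+1)).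
  apply: leq_mul; last by rewrite leq_exp2r.
  by apply: leq_mul (lin s); apply: leq_mul.
rewrite -expnM -!expnD leq_exp2l //; rewrite /s; nia.
Qed.

(** With [k] at least 4, log N is 2 to a tower that is already exponential in [r]. That tower
    exceeds (k m + 2) (s + 1) = O(r^3), so (k m + 2)^(s + 1) is absorbed. *)
Lemma ramsey_bound_uniform4 (q j : nat) : 0 < q -> exists2 C : nat, 0 < C &
  forall m r, m <= r ^ 2 -> 0 < r ->
    er_bound q (j.+4 * r).+1 j.+3 *
      blowup_size q (j.+4 * r).+1 (j.+4 * m) (er_bound q (j.+4 * r).+1 j.+3)
      <= tower2 j.+3 (C * r).
Proof.
move=> q0; have [c c0 hc] := er_bound_le_tower2 j.+3 q0.
(* The first summand gives c s <= C0 r; the second makes [t] dominate [s] and (k m + 2) (s + 1). *)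
set k := j.+4; pose C0 := c * k.+1 + 3 * k.+2 ^ 2.
have C00 : 0 < C0 by rewrite addn_gt0 muln_gt0 c0.
exists ((q + 6) * C0) => [|m r mr r0]; first by rewrite muln_gt0 C00 addn_gt0 orbT.
rewrite -/k; set s := (k * r).+1; pose t := tower2 j.+1 (C0 * r).
have cs0 : 0 < c * s by rewrite muln_gt0 c0.
apply: leq_trans (blowup_size_le (s := s) (L := tower2 j.+2 (c * s)) q _ (hc s isT) _ isT) _.
  by rewrite tower2_gt0.
rewrite [leqRHS]/= leq_exp2l //.
have sr : s <= k.+1 * r by rewrite /s mulSn; lia.
have kk : k.+1 <= k.+2 ^ 2 by rewrite -[2]/(1 + 1) expnD expn1; nia.
have h1 : tower2 j.+1 (c * s) <= t.
  by apply: leq_tower2; rewrite mulnDl -mulnA (leq_trans _ (leq_addr _ _)) // leq_mul2l sr orbT.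
have t0 : 0 < t by rewrite tower2_gt0 // muln_gt0 C00.
have C0r x : x <= 3 * k.+2 ^ 2 * r -> x <= C0 * r.
  by move/leq_trans; apply; rewrite leq_mul2r leq_addl orbT.
have h3 : s <= t.
  have := leq_tower2D 0 j.+1 (C0 * r); rewrite addn0; apply: leq_trans.
  apply: C0r; apply: leq_trans sr _; rewrite leq_mul2r; apply/orP; right; lia.
have h4 : (k * m).+2 * s.+1 <= t.
  have := leq_tower2D 1 j (C0 * r); rewrite addn1; apply: leq_trans.
  apply: (@leq_trans (k.+2 ^ 2 * tower2 1 (3 * r))); last first.
    apply: leq_trans (mul_tower2 _ _ _) _; rewrite ?muln_gt0 ?expn_gt0 ?r0 //.
    by apply: leq_tower2; apply: C0r; rewrite mulnA [k.+2 ^ 2 * 3]mulnC.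
  rewrite /tower2 /= mulnC [3 * r]mulnC expnM.
  (* s + 1 <= (k + 2) r and k m + 2 <= (k + 2) r^2, while r < 2^r. *)
  apply: (@leq_trans (k.+2 ^ 2 * r ^ 3)); last first.
    by rewrite leq_mul2l leq_exp2r // (ltnW (ltn_expl _ _)) ?orbT.
  rewrite (_ : k.+2 ^ 2 * r ^ 3 = k.+2 * r * (k.+2 * r ^ 2)); last by rewrite !expnS; lia.
  have r20 : 0 < r ^ 2 by rewrite expn_gt0 r0.
  apply: leq_mul; first by rewrite /s; lia.
  by rewrite !mulSn addnA -addnS -addnS; nia.
rewrite [tower2 j.+2 (c * s)]/=.
apply: (@leq_trans (2 ^ (q + 3) * 2 ^ t * 2 ^ t * 2 ^ t)).
  have lin a : a <= 2 ^ a by apply/ltnW/ltn_expl.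
  have exp2t a : a <= t -> 2 ^ a <= 2 ^ t by rewrite leq_exp2l.
  apply: leq_mul; last first.
    apply: leq_trans (exp2t _ h4).
    by rewrite expnM leq_exp2r.
  apply: leq_mul (leq_trans (lin s) (exp2t _ h3)).
  exact: leq_mul (lin _) (exp2t _ h1).
rewrite -!expnD leq_exp2l //.
apply: (@leq_trans ((q + 6) * t)); first by nia.
by rewrite -mulnA mul_tower2 ?addn_gt0 ?orbT // muln_gt0 C00.
Qed.

(** * Ramsey numbers and the passage to real bounds *)

Lemma ramsey_number_exists (k q : nat) (V : finType) (E : {set {set V}}) (N : nat) :
  ramsey_property k q E N -> exists2 n, is_ramsey_number k q E n & (n <= N)%N.
Proof.
move=> rN; have ex : exists n, `[< ramsey_property k q E n >] by exists N; apply/asboolP.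
case: (ex_minnP ex) => n /asboolP rn nmin; exists n.
  by split=> // N' rN'; apply: nmin; apply/asboolP.
by apply: nmin; apply/asboolP.
Qed.

(** Take the least r with m <= r^2: if r >= 2, then r <= 2 (r - 1) and (r - 1)^2 < m. *)
Lemma exists_rounded_sqrt (m : nat) : (0 < m)%N ->
  exists r : nat, [/\ (0 < r)%N, (m <= r ^ 2)%N & (r ^ 2 <= 4 * m)%N].
Proof.
move=> m0; have ex : exists r, (m <= r ^ 2)%N by exists m; rewrite leq_pmulr.
case: (ex_minnP ex) => r mr rmin; exists r; split=> //.
  by case: r mr {rmin} => //; rewrite leqNgt m0.
case: r mr rmin => [|[|r]] // mr rmin; first by rewrite muln_gt0.
have : (r.+1 ^ 2 < m)%N by rewrite ltnNge; apply/negP => /rmin; rewrite ltnn.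
rewrite -!mulnn; nia.
Qed.

Lemma ramsey_number_le (k q r : nat) (V : finType) (E : {set {set V}}) :
  (0 < q)%N -> (0 < k)%N -> (0 < #|E|)%N -> (#|E| <= r ^ 2)%N ->
  uniform k E -> (forall v, ~ isolated E v) ->
  exists2 N, is_ramsey_number k q E N &
    (N <= er_bound q (k * r).+1 k.-1 *
      blowup_size q (k * r).+1 (k * #|E|) (er_bound q (k * r).+1 k.-1))%N.
Proof.
move=> q0 k0 E0 Er uE nE; have [f finj] := exists_strong_colouring uE Er.
apply: ramsey_number_exists; apply: (ramsey_property_blowup (f := f)) => //.
- by rewrite muln_gt0 k0.
- exact: er_bound_gt0.
- exact: card_no_isolated.
- by rewrite -{1}(prednK k0); apply: ramsey_complete_er_bound.
Qed.

Local Open Scope ring_scope.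

Lemma tower_nat (R : realType) (k x : nat) :
  (tower2 k.-1 x)%:R = tower k x%:R :> R.
Proof.
rewrite /tower /tower2; elim: k.-1 => //= j IH.
by rewrite -IH powR_mulrn // natrX.
Qed.

Lemma ler_tower (R : realType) (k : nat) (x y : R) : x <= y -> tower k x <= tower k y.
Proof.
by move=> xy; rewrite /tower; elim: k.-1 => //= j IH; apply: ler_powR => //; rewrite ler1n.
Qed.

Lemma natr_le_sqrt (R : realType) (m r : nat) : (r ^ 2 <= 4 * m)%N ->
  r%:R <= 2 * Num.sqrt m%:R :> R.
Proof.
move=> rm; have -> : r%:R = Num.sqrt (r%:R ^+ 2) :> R by rewrite sqrtr_sqr ger0_norm.
have -> : 2 * Num.sqrt m%:R = Num.sqrt ((4 * m)%:R) :> R.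
  rewrite natrM sqrtrM // (_ : 4%:R = 2 ^+ 2 :> R) ?sqrtr_sqr ?ger0_norm //.
  by rewrite -natrX.
by rewrite -natrX ler_sqrt // ler_nat.
Qed.

Theorem theorem7 (R : realType) (q : nat) (hq : (0 < q)%N) :
  (forall k : nat, (4 <= k)%N ->
     exists2 c : R, 0 < c &
       forall (V : finType) (E : {set {set V}}),
         uniform k E -> (forall v : V, ~ isolated E v) ->
         exists2 N : nat, is_ramsey_number k q E N &
           N%:R <= tower k (c * Num.sqrt (#|E|%:R)))
  /\
  (exists2 c : R, 0 < c &
     forall (V : finType) (E : {set {set V}}),
       uniform 3 E -> (forall v : V, ~ isolated E v) -> (2 <= #|E|)%N ->
       exists2 N : nat, is_ramsey_number 3 q E N &
         N%:R <= tower 3 (c * Num.sqrt (#|E|%:R) * ln (#|E|%:R))).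
Proof.
split.
  move=> k; case: k => [|[|[|[|j]]]] // _.
  have [C C0 hC] := ramsey_bound_uniform4 j hq.
  exists (C%:R * 2) => [|V E uE nE]; first by rewrite mulr_gt0 ?ltr0n.
  (* Without edges [V] is empty, since no vertex is isolated; the empty map is then a copy on 0
     vertices. *)
  have [m0|m0] := posnP #|E|.
    have V0 : #|V| = 0%N.
      by apply/eqP; rewrite -leqn0; have := card_no_isolated uE nE; rewrite m0 muln0.
    exists 0%N; last by rewrite powR_ge0.
    split=> // chi; exists (Ordinal hq).
    have noV (v : V) : False by have := card0_eq V0 v; rewrite inE.
    exists (fun v => False_rect _ (noV v)) => [v|e eE]; first by case: (noV v).
    by move: m0 => /eqP; rewrite cards_eq0 => /eqP E0; rewrite E0 inE in eE.
  have [r [r0 mr rm]] := exists_rounded_sqrt m0.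
  have [N rN Nle] := ramsey_number_le hq (isT : (0 < j.+4)%N) m0 mr uE nE.
  exists N => //; have := leq_trans Nle (hC _ _ mr r0).
  rewrite -(ler_nat R) => /le_trans; apply.
  rewrite (tower_nat _ j.+4) ler_tower // natrM -mulrA ler_wpM2l //.
  exact: natr_le_sqrt.
have [C C0 hC] := ramsey_bound_uniform3 hq.
have ln2 : 0 < ln 2 :> R by rewrite ln_gt0 // ltr1n.
(* The 2 comes from r <= 2 sqrt m, and 1 / ln 2 from writing m^(C r) as a power of 2. *)
exists (C%:R * 2 / ln 2) => [|V E uE nE m2]; first by rewrite !mulr_gt0 ?invr_gt0 ?ltr0n.
have m0 := ltnW m2.
have [r [r0 mr rm]] := exists_rounded_sqrt m0.
have [N rN Nle] := ramsey_number_le hq (isT : (0 < 3)%N) m0 mr uE nE.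
exists N => //; have := leq_trans Nle (hC _ _ m2 r0).
rewrite -(ler_nat R) => /le_trans; apply.
rewrite natrX -powR_mulrn //= /tower /=; apply: ler_powR; first by rewrite ler1n.
set m := #|E| in m0 rm *.
have m0R : 0 < m%:R :> R by rewrite ltr0n.
rewrite natrX -powR_mulrn // /powR !gt_eqF // ler_expR.
have -> : C%:R * 2 / ln 2 * Num.sqrt m%:R * ln m%:R * ln 2 =
    C%:R * (2 * Num.sqrt m%:R) * ln m%:R :> R.
  by field; rewrite gt_eqF.
rewrite ler_wpM2r ?ln_ge0 ?ler1n // natrM ler_wpM2l //; exact: natr_le_sqrt.
Qed.
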